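(* Let $l\ge1$ be an integer and let $\{m_k\}_{k\ge1}$ be an enumeration of the integers in $\mathcal D^*(l)$. Then $\{e^{im_kx}\}_{k\ge1}$ is an unconditional convergence system, i.e. for all complex coefficients $c_k$ with $\sum_k|c_k|^2<\infty$ the series $\sum_k c_ke^{im_kx}$ converges for almost every $x$ after any rearrangement of its terms.
   Context: For an integer $s\ge1$, $\mathcal D(s)$ is the set of integers of the form $2^{k_1}+2^{k_2}+\dots+2^{k_s}$ with integers $k_1>k_2>\dots>k_s\ge1$, and $\mathcal D^*(l)=\bigcup_{1\le s\le l}\mathcal D(s)$. An enumeration lists every element exactly once, in an arbitrary order. *)

(* Defs.v *)
From HB Require Import structures.
From mathcomp Require Import all_boot all_order all_algebra complex.
From mathcomp Require Import all_classical all_reals all_analysis.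

Set Implicit Arguments.
Unset Strict Implicit.
Unset Printing Implicit Defensive.

Import Order.TTheory GRing.Theory Num.Theory.
Import numFieldNormedType.Exports.

Local Open Scope classical_set_scope.
Local Open Scope ring_scope.
Local Open Scope complex_scope.

(* Integers 2^k_1 + ... + 2^k_s with k_1 > ... > k_s >= 1. They are all
   positive, so they are represented as natural numbers. *)
Definition dyadic_sums (s : nat) : set nat :=
  [set n | exists k : 'I_s -> nat,
    [/\ forall i j : 'I_s, (i < j)%N -> (k j < k i)%N,
        forall i : 'I_s, (1 <= k i)%N
      & n = (\sum_(i < s) 2 ^ k i)%N]].

Definition dyadic_sums_upto (l : nat) : set nat :=
  \bigcup_(s in [set s | (1 <= s <= l)%N]) dyadic_sums s.

(* Sequences are indexed from 0. *)
Definition enumeration (T : Type) (A : set T) (m : nat -> T) : Prop :=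
  set_bij [set: nat] A m.

(* exp(i t) *)
Definition expi (R : realType) (t : R) : R[i] := cos t +i* sin t.

Definition square_summable (R : realType) (c : nat -> R[i]) : Prop :=
  (\sum_(0 <= k <oo) (Normc.normc (c k) ^+ 2)%:E < +oo)%E.

(* The exceptional null set may depend on the rearrangement sigma.
   The type (R[i])^o carries the usual topology of the complex numbers,
   induced by the modulus. *)
Definition unconditional_convergence_system (R : realType)
    (phi : nat -> R -> R[i]) : Prop :=
  forall c : nat -> R[i], square_summable c ->
  forall sigma : nat -> nat, bijective sigma ->
  {ae @lebesgue_measure R, forall x : R,
    cvgn (series (fun k => c (sigma k) * phi (sigma k) x : (R[i])^o))}.

(* Main.v *)
(* Idea. The frequencies form a Lambda(4) set: if w(n) = 4^(-s(n)), with s(n) the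
   number of binary ones of n, then sum_{a <= n} w(a) w(n - a) <= 1 for every n,
   while w >= 4^(-l) on the frequencies. By Cauchy-Schwarz and Parseval for S^2,
   a trigonometric polynomial S with these frequencies satisfies
   int |S|^4 <= C (sum |c_k|^2)^2. Since this holds for every block of terms in
   every order, and the exponent 2 on the right exceeds 1, a bisection argument
   bounds the fourth moment of the maximal partial sum over a block by the same
   quantity. The tails of the coefficients tend to 0, so the partial sums are
   almost everywhere Cauchy, on each [-p pi, p pi] and hence on the line. *)
Require Import Defs.
From mathcomp Require Import all_boot all_order all_algebra complex.
From mathcomp Require Import all_classical all_reals all_analysis.
From mathcomp Require Import measurable_realfun ring lra zify.

Import Order.TTheory GRing.Theory Num.Theory.
Import numFieldNormedType.Exports.

Local Open Scope classical_set_scope.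
Local Open Scope ring_scope.

(** * Binary digit weights *)

(** Since n < 2 ^ n, the cut-off [i < n] loses no binary digit, so the exponent is the number of
    binary ones of [n]. *)
Definition bit_weight (R : realFieldType) (n : nat) : R :=
  4^-1 ^+ \sum_(i < n) odd (n %/ 2 ^ i).

Lemma bit_weight_gt0 (R : realFieldType) (n : nat) : 0 < bit_weight R n.
Proof. by rewrite exprn_gt0// invr_gt0 ltr0n. Qed.

Lemma bit_weight0 (R : realFieldType) : bit_weight R 0 = 1.
Proof. by rewrite /bit_weight big_ord0. Qed.

Lemma sum_bits_widen (n N : nat) : (n <= N)%N ->
  (\sum_(i < n) odd (n %/ 2 ^ i) = \sum_(i < N) odd (n %/ 2 ^ i))%N.
Proof.
move=> nN; rewrite -!(big_mkord xpredT (fun i => nat_of_bool (odd (n %/ 2 ^ i)))).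
rewrite [RHS](big_cat_nat _ nN)//= -[LHS]addn0; congr (_ + _)%N.
rewrite big_nat_cond big1// => i /andP[/andP[ni _] _]; rewrite divn_small//.
by apply: leq_ltn_trans ni _; exact: ltn_expl.
Qed.

Lemma bit_weightD2 (R : realFieldType) (b : bool) (n : nat) :
  bit_weight R (b + n.*2) = 4^-1 ^+ b * bit_weight R n.
Proof.
rewrite /bit_weight -exprD; congr (_ ^+ _).
rewrite (@sum_bits_widen (b + n.*2) n.*2.+2); last by case: (b); lia.
rewrite (@sum_bits_widen n n.*2.+1); last by lia.
rewrite big_ord_recl divn1 oddD odd_double addbF oddb; congr (_ + _)%N.
apply: eq_bigr => i _; congr (nat_of_bool (odd _)).
by rewrite lift0 expnS divnMA; congr (_ %/ _)%N; case: (b); lia.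
Qed.

Lemma bit_weight_double (R : realFieldType) (n : nat) :
  bit_weight R n.*2 = bit_weight R n.
Proof. by rewrite -[n.*2]/(false + n.*2)%N bit_weightD2 mul1r. Qed.

Lemma bit_weight_doubleS (R : realFieldType) (n : nat) :
  bit_weight R n.*2.+1 = 4^-1 * bit_weight R n.
Proof. by rewrite -[n.*2.+1]/(true + n.*2)%N bit_weightD2 expr1. Qed.

(** Carries only erase ones, so adding a power of 2 creates at most one new one. The induction
    strips the lowest digit: for k = 0 and odd [n] the carry passes to [n./2], and for positive
    exponents the lowest digit is untouched. *)
Lemma bit_weightD_exp2 (R : realFieldType) (k n : nat) :
  4^-1 * bit_weight R n <= bit_weight R (n + 2 ^ k).
Proof.
elim/ltn_ind: n k => n IH [|k].
  rewrite addn1 -[n in X in X <= _]odd_double_half -[n in X in _ <= X]odd_double_half.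
  rewrite bit_weightD2; have w0 := bit_weight_gt0 R (n./2).
  case: (boolP (odd n)) => no /=; last by rewrite add0n bit_weight_doubleS mul1r.
  rewrite add1n -doubleS bit_weight_double expr1.
  have/IH/(_ 0%N) : (n./2 < n)%N by rewrite -divn2 ltn_Pdiv// odd_gt0.
  by rewrite expn0 addn1; lra.
(* Zero is treated apart because halving does not decrease it. *)
have [->|n0] := posnP n.
  rewrite add0n bit_weight0 mulr1; elim: k => [|k IHk].
    by rewrite (bit_weight_double _ 1) (bit_weight_doubleS _ 0) bit_weight0 mulr1.
  by rewrite expnS mul2n bit_weight_double.
rewrite -[n in X in X <= _]odd_double_half -[n in X in _ <= X]odd_double_half.
rewrite expnS mul2n -addnA -doubleD !bit_weightD2 mulrCA ler_wpM2l ?exprn_ge0//.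
by apply: IH; lia.
Qed.

Lemma bit_weight_sum_exp2 (R : realFieldType) (s : nat) (k : 'I_s -> nat) :
  4^-1 ^+ s <= bit_weight R (\sum_(i < s) 2 ^ k i).
Proof.
elim: s k => [|s IH] k; first by rewrite big_ord0 bit_weight0.
rewrite big_ord_recr/= exprS; apply: le_trans (bit_weightD_exp2 _ _ _).
by rewrite ler_wpM2l.
Qed.

Lemma bit_weight_dyadic_sums_upto (R : realFieldType) (l n : nat) :
  dyadic_sums_upto l n -> 4^-1 ^+ l <= bit_weight R n.
Proof.
case=> s /= /andP[_ sl] [k [_ _ ->]]; apply: le_trans (bit_weight_sum_exp2 R s k).
by rewrite ler_wiXn2l// invf_le1 ?ler1n ?ltr0n.
Qed.

Lemma sum_nat_double (V : nmodType) (f : nat -> V) (n : nat) :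
  \sum_(a < n.*2) f a = \sum_(b < n) (f b.*2 + f b.*2.+1).
Proof.
elim: n => [|n IH]; first by rewrite !big_ord0.
by rewrite doubleS !big_ord_recr/= IH addrA.
Qed.

Definition bit_weight_conv (R : realFieldType) (n : nat) : R :=
  \sum_(a < n.+1) bit_weight R a * bit_weight R (n - a).

(** In a pair with sum 2n + 1 exactly one entry is odd. Halving both leaves a pair with sum n, and
    each of the two choices of the odd entry costs a factor 1/4. *)
Lemma bit_weight_conv_odd (R : realFieldType) (n : nat) :
  bit_weight_conv R n.*2.+1 = 2^-1 * bit_weight_conv R n.
Proof.
rewrite /bit_weight_conv -doubleS.
rewrite (sum_nat_double _ (fun a => bit_weight R a * bit_weight R (n.*2.+1 - a))).
rewrite big_distrr/=; apply: eq_bigr => -[b /= bn] _.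
have -> : (n.*2.+1 - b.*2 = (n - b).*2.+1)%N by lia.
have -> : (n.*2.+1 - b.*2.+1 = (n - b).*2)%N by lia.
by rewrite !bit_weight_double !bit_weight_doubleS; field.
Qed.

(** Pairs with sum 2(n + 1) are either both even, halving to sum n + 1 at no cost, or both odd,
    halving to sum n with a factor 1/16. *)
Lemma bit_weight_conv_double (R : realFieldType) (n : nat) :
  bit_weight_conv R n.+1.*2 =
  bit_weight_conv R n.+1 + 16^-1 * bit_weight_conv R n.
Proof.
rewrite /bit_weight_conv big_ord_recr/=.
rewrite (sum_nat_double _ (fun a => bit_weight R a * bit_weight R (n.+1.*2 - a))).
rewrite subnn bit_weight_double big_split/= addrAC; congr (_ + _).
  rewrite [RHS]big_ord_recr/= subnn; congr (_ + _); apply: eq_bigr => -[b /= bn] _.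
  by rewrite -doubleB !bit_weight_double.
rewrite big_distrr/=; apply: eq_bigr => -[b /= bn] _.
have -> : (n.+1.*2 - b.*2.+1 = (n - b).*2.+1)%N by lia.
by rewrite !bit_weight_doubleS; field.
Qed.

Lemma bit_weight_conv_ge0 (R : realFieldType) (n : nat) : 0 <= bit_weight_conv R n.
Proof. by apply: sumr_ge0 => a _; rewrite mulr_ge0// ltW// bit_weight_gt0. Qed.

Lemma bit_weight_conv0 (R : realFieldType) : bit_weight_conv R 0 = 1.
Proof. by rewrite /bit_weight_conv big_ord_recl big_ord0 bit_weight0 mulr1 addr0. Qed.

(* The extra term [bit_weight_conv R n / 8] is what makes the induction on the
   binary expansion close: the even case brings in the predecessor. *)
Lemma bit_weight_conv_step (R : realFieldType) (n : nat) :
  bit_weight_conv R n.+1 + 8^-1 * bit_weight_conv R n <= 1.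
Proof.
elim/ltn_ind: n => n IH; have F0 := bit_weight_conv_ge0 R.
rewrite -[n]odd_double_half; case: (boolP (odd n)) => no; last first.
  rewrite add0n bit_weight_conv_odd; case E : n./2 => [|p].
    by rewrite double0 bit_weight_conv0; lra.
  rewrite bit_weight_conv_double.
  have/IH : (p < n)%N by lia.
  by have := F0 p; have := F0 p.+1; lra.
(* Here the inequality reproduces itself at [n./2]: the lower term gets the coefficient 1/16 + 1/8 *
   1/2 = 1/8, which explains that constant. *)
rewrite add1n -doubleS bit_weight_conv_double bit_weight_conv_odd.
have/IH : (n./2 < n)%N by rewrite -divn2 ltn_Pdiv// odd_gt0.
by have := F0 (n./2); lra.
Qed.

Lemma bit_weight_conv_le1 (R : realFieldType) (n : nat) : bit_weight_conv R n <= 1.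
Proof.
case: n => [|n]; first by rewrite bit_weight_conv0.
by have := bit_weight_conv_step R n; have := bit_weight_conv_ge0 R n; lra.
Qed.

(** * Trigonometric polynomials *)

Section TrigonometricPolynomials.
Variable R : realType.
Implicit Types (P : {poly R[i]}) (t x b : R) (f : R -> R).

Lemma expiD (s t : R) : expi (s + t) = expi s * expi t.
Proof.
rewrite /expi sinD cosD; apply/eqP; rewrite eq_complex/= eqxx/=.
by apply/eqP; ring.
Qed.

Lemma conjc_expi t : ((expi t)^*)%C = expi (- t).
Proof. by rewrite /expi sinN cosN. Qed.

Lemma expi_natmul (n : nat) t : expi (n%:R * t) = expi t ^+ n.
Proof.
elim: n => [|n IH].
  by rewrite mul0r expr0 /expi cos0 sin0.
by rewrite exprS -IH -natr1 mulrDl mul1r addrC expiD.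
Qed.

Lemma sqr_normc (z : R[i]) : Normc.normc z ^+ 2 = complex.Re (z * (z^*)%C).
Proof.
case: z => u v /=; rewrite sqr_sqrtr ?addr_ge0 ?sqr_ge0//.
by rewrite mulrN opprK !expr2.
Qed.

Lemma normc_ge0 (z : R[i]) : 0 <= Normc.normc z.
Proof. by case: z => u v; exact: sqrtr_ge0. Qed.

Lemma Re_sum (I : Type) (s : seq I) (F : I -> R[i]) :
  complex.Re (\sum_(k <- s) F k) = \sum_(k <- s) complex.Re (F k).
Proof. by apply: (big_morph _ (id1 := 0)) => // -[? ?] [? ?]. Qed.

Lemma Im_sum (I : Type) (s : seq I) (F : I -> R[i]) :
  complex.Im (\sum_(k <- s) F k) = \sum_(k <- s) complex.Im (F k).
Proof. by apply: (big_morph _ (id1 := 0)) => // -[? ?] [? ?]. Qed.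

(** Keeping a primitive instead of an integral makes finite sums a matter of differentiation only;
    the fundamental theorem of calculus is applied once, in [parseval]. *)
Definition has_integral_by_primitive b f (v : R) :=
  continuous f /\
  exists F : R -> R, (forall x : R, is_derive x 1 F (f x)) /\ F b - F (- b) = v.

Lemma has_integral_by_primitive_sum b (I : Type) (s : seq I)
    (f : I -> R -> R) (v : I -> R) :
  (forall k, has_integral_by_primitive b (f k) (v k)) ->
  has_integral_by_primitive b (fun x => \sum_(k <- s) f k x) (\sum_(k <- s) v k).
Proof.
move=> fv; elim: s => [|k s [cs [F [dF Fv]]]].
  have -> : (fun x => \sum_(k <- [::]) f k x) = cst 0.
    by apply/funext => x; rewrite big_nil.
  split; first exact: cst_continuous.
  exists (cst 0); split; last by rewrite /cst subrr big_nil.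
  by move=> x; exact: is_derive_cst.
have -> : (fun x => \sum_(j <- k :: s) f j x) = (fun x => f k x + \sum_(j <- s) f j x).
  by apply/funext => x; rewrite big_cons.
have [ck [G [dG Gv]]] := fv k; split.
  by move=> x; apply: cvgD; [exact: ck|exact: cs].
exists (G + F); split; last by rewrite big_cons -Gv -Fv !fctE; ring.
by move=> x; exact: is_deriveD.
Qed.

Lemma sin_natmul_pi (n : nat) : sin (n%:R * pi : R) = 0.
Proof.
elim: n => [|n IH]; first by rewrite mul0r sin0.
by rewrite -natr1 mulrDl mul1r sinDpi IH oppr0.
Qed.

(** Orthogonality of characters. The factor [u] and the real part match the terms of an expanded
    squared modulus; the number [p] of periods stays free so that the intervals can exhaust the
    line. *)
Lemma integral_expi_cst (p : nat) (u : R[i]) (n m : nat) :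
  has_integral_by_primitive (p%:R * pi)
    (fun x => complex.Re (u * expi ((n%:R - m%:R) * x)))
    ((n == m)%:R * (2 * (p%:R * pi) * complex.Re u)).
Proof.
have ReE x : complex.Re (u * expi x) = complex.Re u * cos x - complex.Im u * sin x.
  by case: u.
set g := fun x => _.
have gE : g = fun x => complex.Re u * cos ((n%:R - m%:R) * x) -
                       complex.Im u * sin ((n%:R - m%:R) * x).
  by apply/funext => x; rewrite /g ReE.
have dl (a x : R) : is_derive x 1 (fun y : R => a * y) a.
  have := @is_deriveZ R _ _ id a x 1 1 (is_derive_id _ _).
  by rewrite /GRing.scale/= mulr1.
split.
  have cl : continuous (fun y : R => (n%:R - m%:R) * y) by exact: mulrl_continuous.
  have cc : continuous (fun y : R => cos ((n%:R - m%:R) * y)).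
    by move=> x; exact: (continuous_comp (cl x) (@continuous_cos R _)).
  have cs : continuous (fun y : R => sin ((n%:R - m%:R) * y)).
    by move=> x; exact: (continuous_comp (cl x) (@continuous_sin R _)).
  rewrite gE => x; apply: cvgB; apply: cvgM; by [exact: cvg_cst|exact: cc|exact: cs].
have [nm|nm] := eqVneq n m.
  exists (fun x => complex.Re u * x); split; last by rewrite mul1r; ring.
  by move=> x; rewrite gE nm subrr mul0r cos0 sin0 mulr1 mulr0 subr0.
have l0 : (n%:R - m%:R : R) != 0 by rewrite subr_eq0 eqr_nat.
set a := n%:R - m%:R in gE l0 *.
exists (fun x => (complex.Re u / a) * sin (a * x) + (complex.Im u / a) * cos (a * x)).
split.
  move=> x; rewrite gE.
  have ds : is_derive x 1 (@sin R \o (fun y => a * y)) (cos (a * x) * a).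
    exact: is_derive1_comp.
  have dc : is_derive x 1 (@cos R \o (fun y => a * y)) (- sin (a * x) * a).
    exact: is_derive1_comp.
  have := is_deriveD (@is_deriveZ _ _ _ _ (complex.Re u / a) _ _ _ ds)
                     (@is_deriveZ _ _ _ _ (complex.Im u / a) _ _ _ dc).
  rewrite /GRing.scale/= => /is_derive_eq; apply.
  by field.
(* At the two endpoints the sine vanishes and the cosine takes equal values, so the primitive has no
   increment. *)
have s0 : sin (a * (p%:R * pi)) = 0.
  by rewrite /a mulrBl sinB !mulrA -!natrM !sin_natmul_pi mul0r mulr0 subrr.
by rewrite mul0r !mulrN sinN cosN s0 oppr0; ring.
Qed.

(** Expanding the squared modulus into a double sum leaves only the diagonal after integration.
    Continuity is exported because measurability is derived from it. *)
Lemma parseval (p : nat) P : (0 < p)%N ->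
  continuous (fun x => Normc.normc P.[expi x] ^+ 2) /\
  (\int[lebesgue_measure]_(x in `[(- (p%:R * pi))%R, (p%:R * pi)%R])
     (Normc.normc P.[expi x] ^+ 2)%:E =
   (2 * (p%:R * pi) * \sum_(n < size P) Normc.normc P`_n ^+ 2)%:E)%E.
Proof.
move=> p0; set b := p%:R * pi.
have E : (fun x => Normc.normc P.[expi x] ^+ 2) =
    (fun x => \sum_(n < size P) \sum_(m < size P)
       complex.Re (P`_n * ((P`_m)^*)%C * expi ((n%:R - m%:R) * x))).
  apply/funext => x; rewrite sqr_normc horner_coef rmorph_sum big_distrlr Re_sum/=.
  apply: eq_bigr => n _; rewrite Re_sum; apply: eq_bigr => m _.
  congr complex.Re; rewrite mulrBl expiD rmorphM/= -!expi_natmul conjc_expi.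
  by ring.
have [cf [F [dF Fv]]] := has_integral_by_primitive_sum _ _ (index_enum _)
  _ _ (fun n : 'I_(size P) => has_integral_by_primitive_sum _ _ (index_enum _)
  _ _ (fun m : 'I_(size P) => integral_expi_cst p (P`_n * ((P`_m)^*)%C) n m)).
rewrite -E in cf dF; split => //.
have b0 : 0 < b by rewrite mulr_gt0 ?pi_gt0// ltr0n.
have bb : - b < b by lra.
rewrite (@continuous_FTC2 _ _ F) //.
- rewrite -EFinB Fv; congr EFin; rewrite mulr_sumr; apply: eq_bigr => n _.
  rewrite (bigD1 n)//= eqxx mul1r -sqr_normc big1 ?addr0// => m mn.
  by rewrite -val_eqE/= eq_sym in mn; rewrite (negbTE mn) mul0r.
- exact: continuous_subspaceT.
- have cF x : {for x, continuous F}.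
    by apply: differentiable_continuous; apply/derivable1_diffP; have ? := dF x; exact: ex_derive.
  have ex x : derivable F x 1 by have ? := dF x; exact: ex_derive.
  split; first by move=> x _; exact: ex.
    by apply: cvg_at_right_filter; exact: cF.
  by apply: cvg_at_left_filter; exact: cF.
- move=> x _; rewrite derive1E. have ? := dF x.
  by rewrite derive_val; move/(congr1 (@^~ x)): E => ->.
Qed.

Lemma measurable_normc_trig P (D : set R) :
  measurable_fun D (fun x => Normc.normc P.[expi x]).
Proof.
have [cf _] := parseval 1 P (ltnSn 0).
have -> : (fun x => Normc.normc P.[expi x]) =
    @Num.sqrt R \o (fun x => Normc.normc P.[expi x] ^+ 2).
  by apply/funext => x; rewrite /= sqrtr_sqr ger0_norm ?normc_ge0.
apply: measurable_funTS; apply: measurableT_comp.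
  by apply: continuous_measurable_fun; exact: sqrt_continuous.
exact: continuous_measurable_fun.
Qed.

End TrigonometricPolynomials.

(** * Weighted Cauchy-Schwarz and the fourth moment *)

Lemma sqr_normc_sum_le (R : realType) (I : finType) (w : I -> R) (z : I -> R[i]) :
  (forall i, 0 < w i) -> \sum_i w i <= 1 ->
  Normc.normc (\sum_i z i) ^+ 2 <= \sum_i (w i)^-1 * Normc.normc (z i) ^+ 2.
Proof.
move=> w0 w1; set t := \sum_i Normc.normc (z i).
have t0 : 0 <= t by apply: sumr_ge0 => i _; exact: normc_ge0.
have zt : Normc.normc (\sum_i z i) <= t.
  apply: (big_ind2 (fun (u : R[i]) (v : R) => Normc.normc u <= v)) => //.
    by rewrite Normc.normc0.
  by move=> u1 v1 u2 v2 h1 h2; apply: le_trans (le_normcD _ _) _; exact: lerD.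
apply: (@le_trans _ _ (t ^+ 2)); first by rewrite lerXn2r ?nnegrE ?normc_ge0.
(* Expand [0 <= sum_i w_i (|z_i| / w_i - t)^2]. *)
have : 0 <= \sum_i w i * ((w i)^-1 * Normc.normc (z i) - t) ^+ 2.
  by apply: sumr_ge0 => i _; rewrite mulr_ge0 ?sqr_ge0// ltW.
rewrite (eq_bigr (fun i => (w i)^-1 * Normc.normc (z i) ^+ 2
                           - 2 * t * Normc.normc (z i) + t ^+ 2 * w i)); last first.
  by move=> i _; have := lt0r_neq0 (w0 i) => wn; field.
rewrite big_split big_split/= sumrN -!mulr_sumr -/t.
(* The right side is now at least 2 t^2 - t^2 * [\sum_i w i], hence at least t^2, as the total
   weight is at most 1. *)
by have := sqr_ge0 t; nra.
Qed.

(** The value at 1 is the full sum of coefficients. The cut-off [N] is independent of [q] because it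
    will be the size of another polynomial. *)
Lemma sum_coef_le_horner1 (R : realType) (q : {poly R}) (N : nat) :
  (forall n, 0 <= q`_n) -> \sum_(n < N) q`_n <= q.[1].
Proof.
move=> q0; rewrite (@horner_coef_wide _ (maxn N (size q))) ?leq_maxr//.
under [leRHS]eq_bigr do rewrite expr1n mulr1.
rewrite (big_ord_widen (maxn N (size q)) (fun n => q`_n)) ?leq_maxl//.
by rewrite [leLHS]big_mkcond/=; apply: ler_sum => n _; case: ifP.
Qed.

(* Cauchy-Schwarz with weights [bit_weight a * bit_weight (n - a)] in each
   coefficient of P * P; the weights have sum at most 1. *)
Lemma sum_normc_sqr_coef (R : realType) (l : nat) (P : {poly R[i]}) :
  (forall a, P`_a != 0 -> 4^-1 ^+ l <= bit_weight R a) ->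
  \sum_(n < size (P * P)) Normc.normc (P * P)`_n ^+ 2 <=
  16 ^+ l * (\sum_(a < size P) Normc.normc P`_a ^+ 2) ^+ 2.
Proof.
move=> Pw; set e := fun a => Normc.normc P`_a ^+ 2.
have e0 a : 0 <= e a by exact: sqr_ge0.
(* The coefficients of [U * U] are the convolutions that Cauchy-Schwarz produces, and their total is
   [U.[1] ^+ 2], the square of the sum of the squared moduli. *)
pose U := \poly_(a < size P) e a.
have UE a : U`_a = e a.
  rewrite coef_poly; case: ltnP => // aP.
  by rewrite /e nth_default// Normc.normc0 expr0n.
have -> : \sum_(a < size P) e a = U.[1].
  rewrite (@horner_coef_wide _ (size P)) ?size_poly//.
  by apply: eq_bigr => a _; rewrite UE expr1n mulr1.
have UU0 n : 0 <= (U * U)`_n.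
  by rewrite coefM sumr_ge0// => a _; rewrite !UE mulr_ge0.
have -> : U.[1] ^+ 2 = (U * U).[1] by rewrite hornerM expr2.
apply: (@le_trans _ _ (16 ^+ l * \sum_(n < size (P * P)) (U * U)`_n)); last first.
  by rewrite ler_wpM2l ?exprn_ge0 ?sum_coef_le_horner1.
rewrite mulr_sumr; apply: ler_sum => -[n _] _ /=; rewrite coefM.
apply: (le_trans (@sqr_normc_sum_le _ _
  (fun a : 'I_n.+1 => bit_weight R a * bit_weight R (n - a)) _ _ _)).
- by move=> a; rewrite mulr_gt0 ?bit_weight_gt0.
- exact: bit_weight_conv_le1.
rewrite coefM mulr_sumr; apply: ler_sum => a _; rewrite !UE /e Normc.normcM exprMn.
(* The lower bound on the weights holds only on the support of [P]; off the support the term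
   vanishes. *)
have [->|Pa] := eqVneq P`_a 0; first by rewrite Normc.normc0 expr0n/= !(mul0r,mulr0).
have [->|Pb] := eqVneq P`_(n - a) 0; first by rewrite Normc.normc0 expr0n/= !mulr0.
rewrite ler_wpM2r ?mulr_ge0 ?normc_ge0//.
rewrite invf_ple ?posrE ?exprn_gt0 ?mulr_gt0 ?bit_weight_gt0//.
rewrite -exprVn (_ : 16^-1 = 4^-1 * 4^-1 :> R); last by field.
by rewrite exprMn ler_pM ?exprn_ge0 ?invr_ge0 ?ler0n ?Pw.
Qed.

(** This is [parseval] for [P * P], because |P|^4 = |P^2|^2. *)
Lemma fourth_moment_le (R : realType) (p l : nat) (P : {poly R[i]}) : (0 < p)%N ->
  (forall a, P`_a != 0 -> 4^-1 ^+ l <= bit_weight R a) ->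
  (\int[lebesgue_measure]_(x in `[(- (p%:R * pi))%R, (p%:R * pi)%R])
     (Normc.normc P.[expi x] ^+ 4)%:E <=
   (2 * (p%:R * pi) * (16 ^+ l *
     (\sum_(a < size P) Normc.normc P`_a ^+ 2) ^+ 2))%:E)%E.
Proof.
move=> p0 Pw; have [_] := @parseval R p (P * P) p0.
under eq_integral do rewrite hornerM Normc.normcM -expr2 -exprM.
move=> ->; rewrite lee_fin ler_wpM2l ?sum_normc_sqr_coef//.
by rewrite !mulr_ge0 ?pi_ge0.
Qed.

(** At most one [k] satisfies [n k = a], so the square has no cross terms. *)
Lemma sqr_normc_sum_disjoint (R : realType) (I : eqType) (s : seq I)
    (c : I -> R[i]) (n : I -> nat) (a : nat) : uniq [seq n k | k <- s] ->
  Normc.normc (\sum_(k <- s) c k * (a == n k)%:R) ^+ 2 =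
  \sum_(k <- s) Normc.normc (c k) ^+ 2 * (a == n k)%:R.
Proof.
elim: s => [|k s IH]; first by rewrite !big_nil Normc.normc0 expr0n.
rewrite /= !big_cons => /andP[ks us].
have [->|ak] := eqVneq a (n k); last by rewrite !mulr0 !add0r IH.
by rewrite !big_seq !big1 ?addr0 ?mulr1// => j js;
  case: eqP ks => [->|_ _]; rewrite ?mulr0 ?map_f.
Qed.

Lemma sum_sqr_normc_coef_le (R : realType) (I : eqType) (s : seq I)
    (c : I -> R[i]) (n : I -> nat) (N : nat) : uniq [seq n k | k <- s] ->
  \sum_(a < N) Normc.normc (\sum_(k <- s) (c k)%:P * 'X^(n k))`_a ^+ 2 <=
  \sum_(k <- s) Normc.normc (c k) ^+ 2.
Proof.
move=> us; under eq_bigr.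
  move=> a _; rewrite coef_sum; under eq_bigr do rewrite coefCM coefXn.
  rewrite sqr_normc_sum_disjoint//; over.
rewrite exchange_big/=; apply: ler_sum => k _; rewrite -mulr_sumr.
rewrite -[leRHS]mulr1 ler_wpM2l ?sqr_ge0//.
have [kN|Nk] := ltnP (n k) N.
  rewrite (bigD1 (Ordinal kN))//= eqxx big1 ?addr0// => a.
  by rewrite -val_eqE/= => /negbTE ->.
rewrite big1 ?ler01// => a _; case: eqP => // E.
by move: (ltn_ord a); rewrite E ltnNge Nk.
Qed.

(** * Maximal inequality *)

(** What matters is that 3/2 is below 2: bisection multiplies it by 1/4 + 1/4 and must yield a
    contraction. The price is the large factor on [a ^+ 4]. *)
Lemma expr4D_le (R : realFieldType) (a b : R) :
  (a + b) ^+ 4 <= 2 ^+ 10 * a ^+ 4 + 3 / 2 * b ^+ 4.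
Proof.
(* With the four squares in order, right side minus left side equals h1 + 2 h2 + h3 + 445 h4. *)
have h1 := sqr_ge0 (b * (b / 2 - 4 * a)); have h2 := sqr_ge0 (a * (a - b)).
have h3 := sqr_ge0 (b ^+ 2 / 2 - 24 * a ^+ 2); have h4 := sqr_ge0 (a ^+ 2).
by lra.
Qed.

Lemma expr4_max_le (R : realFieldType) (a b : R) :
  Num.max a b ^+ 4 <= a ^+ 4 + b ^+ 4.
Proof.
have ha := sqr_ge0 (a ^+ 2); have hb := sqr_ge0 (b ^+ 2).
by case: (leP a b) => _; lra.
Qed.

(** Take the least [m] whose sum through [m] reaches half the total: the sum before [m] is below
    half and the sum after [m] is at most half. The term [e m], possibly large, belongs to neither
    part. *)
Lemma bisect_sum (R : realFieldType) (e : nat -> R) (i j : nat) :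
  (forall k, 0 <= e k) -> (i < j)%N ->
  exists m, [/\ (i <= m < j)%N,
    \sum_(i <= k < m.+1) e k <= \sum_(i <= k < j) e k,
    \sum_(i <= k < m) e k <= (\sum_(i <= k < j) e k) / 2 &
    \sum_(m.+1 <= k < j) e k <= (\sum_(i <= k < j) e k) / 2].
Proof.
move=> e0 ij; set G := \sum_(i <= k < j) e k.
have G0 : 0 <= G by exact: sumr_ge0.
pose Q m := (i <= m < j)%N && (G / 2 <= \sum_(i <= k < m.+1) e k).
have exQ : exists m, Q m.
  exists j.-1; rewrite /Q (ltn_predK ij) -/G.
  by apply/andP; split; [lia|lra].
case: (ex_minnP exQ) => m /andP[/andP[im mj] Gm] mmin.
have Gsplit : \sum_(i <= k < m.+1) e k + \sum_(m.+1 <= k < j) e k = G.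
  by rewrite /G [RHS](@big_cat_nat _ _ _ m.+1)//; lia.
exists m; split; first by rewrite im.
- by rewrite -Gsplit lerDl sumr_ge0.
(* For m = i the part before [m] is empty, and minimality cannot be used since [m.-1] would leave
   the range. *)
- have [->|mi] := eqVneq m i; first by rewrite big_geq//; lra.
  rewrite leNgt; apply/negP => Gm1.
  have : Q m.-1 by rewrite /Q prednK; [apply/andP; split; [lia|exact: ltW]|lia].
  by move/mmin; lia.
- by lra.
Qed.

Section MaximalInequality.
Context {d : measure_display} {T : measurableType d} {R : realType}.
Variables (mu : {measure set T -> \bar R}) (D : set T) (mD : measurable D).
(** In the application [N i j x] is the modulus at [x] of the block of terms with i <= k < j, and
    [e k] is the squared modulus of a coefficient. *)
Variables (N : nat -> nat -> T -> R) (e : nat -> R) (K : R).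
Hypothesis N_ge0 : forall i j x, 0 <= N i j x.
Hypothesis N_refl : forall i x, N i i x = 0.
Hypothesis N_triangle : forall i j k x, (i <= j <= k)%N ->
  N i k x <= N i j x + N j k x.
Hypothesis measurable_N : forall i j, measurable_fun D (N i j).
Hypothesis e_ge0 : forall k, 0 <= e k.
Hypothesis K_ge0 : 0 <= K.
Hypothesis N_moment : forall i j, (i <= j)%N ->
  (\int[mu]_(x in D) (N i j x ^+ 4)%:E <= (K * (\sum_(i <= k < j) e k) ^+ 2)%:E)%E.

Definition maxN (i j : nat) (x : T) : R := \big[Num.max/0]_(i <= k < j.+1) N i k x.

Lemma maxN_ge0 i j x : 0 <= maxN i j x.
Proof. exact: bigmax_ge_id. Qed.

Lemma le_maxN i j k x : (i <= k <= j)%N -> N i k x <= maxN i j x.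
Proof.
by move=> ikj; apply: le_bigmax_seq => //; rewrite mem_index_iota ltnS.
Qed.

Lemma maxN_le i j x (B : R) : 0 <= B ->
  (forall k, (i <= k <= j)%N -> N i k x <= B) -> maxN i j x <= B.
Proof.
move=> B0 NB; rewrite /maxN big_nat.
by apply: bigmax_le => // k; rewrite ltnS; exact: NB.
Qed.

Lemma maxN_refl i x : maxN i i x = 0.
Proof.
apply/eqP; rewrite eq_le maxN_ge0 andbT; apply: maxN_le => // k iki.
by rewrite (_ : k = i) ?N_refl//; lia.
Qed.

(** Blocks ending by [m] are covered by the first maximum; a longer one is cut at m + 1 with the
    triangle inequality. *)
Lemma maxN_split i j m x : (i <= m < j)%N ->
  maxN i j x <= N i m.+1 x + Num.max (maxN i m x) (maxN m.+1 j x).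
Proof.
move=> /andP[im mj]; apply: maxN_le => [|k /andP[ik kj]].
  by rewrite addr_ge0// le_max maxN_ge0.
have [km|mk] := leqP k m.
  by rewrite ler_wpDl// le_max le_maxN// ik.
apply: le_trans (N_triangle _ _ _ _ (_ : i <= m.+1 <= k)%N) _; first by lia.
by rewrite lerD2l le_max (@le_maxN m.+1 j k) ?orbT//; lia.
Qed.

Lemma measurable_maxN i j : measurable_fun D (maxN i j).
Proof.
rewrite /maxN; elim: (index_iota _ _) => [|k s IH].
  by under eq_fun do rewrite big_nil; exact: measurable_cst.
by under eq_fun do rewrite big_cons; exact: measurable_maxr.
Qed.

(* Bisection (Moricz): split the mass at an index m; (a + b)^4 <= C a^4 + 3/2 b^4
   applied to [maxN_split] gains the factor 3/2 * (1/4 + 1/4) < 1. *)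
Lemma moricz i j : (i <= j)%N ->
  (\int[mu]_(x in D) (maxN i j x ^+ 4)%:E <=
   (2 ^+ 12 * K * (\sum_(i <= k < j) e k) ^+ 2)%:E)%E.
Proof.
(* The constant solves 2^10 K + 3/2 (A/4 + A/4) = A, the balance checked at the end of the
   induction. *)
have [A AE A0] : exists2 A, A = 2 ^+ 12 * K & 0 <= A.
  by exists (2 ^+ 12 * K) => //; rewrite mulr_ge0 ?exprn_ge0.
rewrite -AE; move En : (j - i)%N => n; elim/ltn_ind: n i j En => n IH i j En.
rewrite leq_eqVlt => /predU1P[<-|ij].
  rewrite big_geq// expr0n mulr0 integral0_eq// => x _.
  by rewrite maxN_refl expr0n.
have [m [imj G0 G1 G2]] := bisect_sum _ _ _ _ e_ge0 ij.
have I1 : (\int[mu]_(x in D) (maxN i m x ^+ 4)%:E <=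
   (A * (\sum_(i <= k < m) e k) ^+ 2)%:E)%E.
  by apply: (IH (m - i)%N) => //; clear -imj En; lia.
have I2 : (\int[mu]_(x in D) (maxN m.+1 j x ^+ 4)%:E <=
   (A * (\sum_(m.+1 <= k < j) e k) ^+ 2)%:E)%E.
  by apply: (IH (j - m.+1)%N) => //; clear -imj En; lia.
have I3 : (\int[mu]_(x in D) (N i m.+1 x ^+ 4)%:E <=
   (K * (\sum_(i <= k < m.+1) e k) ^+ 2)%:E)%E by apply: N_moment; clear -imj; lia.
have mX (f : T -> R) : measurable_fun D f -> measurable_fun D (fun x => (f x ^+ 4)%:E).
  by move=> mf; apply/measurable_EFinP; exact: measurable_funX.
have X0 (f : T -> R) x : D x -> (0 <= (f x ^+ 4)%:E)%E.
  by move=> _; rewrite lee_fin exprn_even_ge0.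
have mM i' j' := mX _ (measurable_maxN i' j').
have mN i' j' := mX _ (measurable_N i' j').
have M0 i' j' := X0 (maxN i' j').
have N0 i' j' := X0 (N i' j').
pose S x := ((maxN i m x ^+ 4)%:E + (maxN m.+1 j x ^+ 4)%:E)%E.
have S0 x : D x -> (0 <= S x)%E by move=> Dx; exact: adde_ge0 (M0 _ _ _ Dx) (M0 _ _ _ Dx).
have mS : measurable_fun D S by exact: emeasurable_funD.
have mZ k (f : T -> \bar R) : measurable_fun D f -> measurable_fun D (fun x => k%:E * f x)%E.
  by apply: emeasurable_funM; exact: measurable_cst.
have Z0 k (f : T -> \bar R) : 0 <= k -> (forall x, D x -> (0 <= f x)%E) ->
    forall x, D x -> (0 <= k%:E * f x)%E.
  by move=> k0 f0 x Dx; exact: mule_ge0 (f0 x Dx).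
have c1 : 0 <= 2 ^+ 10 :> R by rewrite exprn_ge0.
have c2 : 0 <= 3 / 2 :> R by rewrite divr_ge0.
have mZN := mZ (2 ^+ 10) _ (mN i m.+1); have mZS := mZ (3 / 2) _ mS.
have ZN0 := Z0 _ _ c1 (N0 i m.+1); have ZS0 := Z0 _ _ c2 S0.
have pw x : D x ->
    ((maxN i j x ^+ 4)%:E <= (2 ^+ 10)%:E * (N i m.+1 x ^+ 4)%:E + (3 / 2)%:E * S x)%E.
  move=> _; rewrite /S -EFinD lee_fin.
  apply: (@le_trans _ _ ((N i m.+1 x + Num.max (maxN i m x) (maxN m.+1 j x)) ^+ 4)).
    by rewrite lerXn2r ?nnegrE ?maxN_split ?maxN_ge0// addr_ge0// le_max maxN_ge0.
  by apply: le_trans (expr4D_le _ _ _) _; rewrite lerD2l ler_wpM2l ?expr4_max_le.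
apply: le_trans (ge0_le_integral mu mD (M0 i j) (mM i j) (emeasurable_funD mZN mZS) pw) _.
rewrite (ge0_integralD mu mD ZN0 mZN ZS0 mZS).
rewrite (ge0_integralZl_EFin mu mD (N0 i m.+1) (mN i m.+1) c1).
rewrite (ge0_integralZl_EFin mu mD S0 mS c2).
rewrite (ge0_integralD mu mD (M0 _ _) (mM _ _) (M0 _ _) (mM _ _)).
set g := \sum_(i <= k < j) e k in G0 G1 G2 *.
apply: (@le_trans _ _ ((2 ^+ 10)%:E * (K * g ^+ 2)%:E +
  (3 / 2)%:E * ((A * (g / 2) ^+ 2)%:E + (A * (g / 2) ^+ 2)%:E))%E).
  have e0 i' j' : 0 <= \sum_(i' <= k < j') e k by exact: sumr_ge0.
  have g0 : 0 <= g := e0 i j.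
  apply: leeD; apply: lee_wpmul2l; rewrite ?lee_fin//.
    by apply: le_trans I3 _; rewrite lee_fin ler_wpM2l// lerXn2r ?nnegrE ?g0 ?e0.
  apply: leeD; [apply: le_trans I1 _|apply: le_trans I2 _];
    by rewrite lee_fin ler_wpM2l// lerXn2r ?nnegrE ?divr_ge0 ?e0.
rewrite -EFinD lee_fin AE; lra.
Qed.

(** * From the maximal inequality to almost everywhere small tails *)

Hypothesis e_tail : forall r : R, 0 < r ->
  exists i, forall j, (i <= j)%N -> \sum_(i <= k < j) e k <= r.

(** The sequence is nondecreasing in [j], so this is a supremum, possibly infinite; the limit form
    suits monotone convergence. *)
Definition supN4 (i : nat) (x : T) : \bar R := limn (fun j => (maxN i j x ^+ 4)%:E).

Lemma nondecreasing_maxN4 i x :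
  {homo (fun j => (maxN i j x ^+ 4)%:E) : j k / (j <= k)%N >-> (j <= k)%E}.
Proof.
move=> j k jk; rewrite lee_fin lerXn2r ?nnegrE ?maxN_ge0//.
apply: maxN_le => [|k' /andP[ik kj]]; first exact: maxN_ge0.
by apply: le_maxN; rewrite ik (leq_trans kj).
Qed.

Lemma le_supN4 i j x : (i <= j)%N -> ((N i j x ^+ 4)%:E <= supN4 i x)%E.
Proof.
move=> ij; rewrite /supN4 (cvg_lim _ (ereal_nondecreasing_cvgn (nondecreasing_maxN4 i x)))//.
apply: (@le_trans _ _ (maxN i j x ^+ 4)%:E); last first.
  by apply: ereal_sup_ubound; exists j.
by rewrite lee_fin lerXn2r ?nnegrE ?maxN_ge0// le_maxN// ij leqnn.
Qed.

Lemma measurable_maxN4 i j : measurable_fun D (fun x => (maxN i j x ^+ 4)%:E).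
Proof.
by apply/measurable_EFinP; apply: measurable_funX; exact: measurable_maxN.
Qed.

Lemma maxN4_ge0 i j x : D x -> (0 <= (maxN i j x ^+ 4)%:E)%E.
Proof. by move=> _; rewrite lee_fin exprn_even_ge0. Qed.

Lemma supN4_ge0 i x : (0 <= supN4 i x)%E.
Proof.
by apply: le_trans (le_supN4 i i x (leqnn i)); rewrite lee_fin exprn_ge0.
Qed.

Lemma measurable_supN4 i : measurable_fun D (supN4 i).
Proof.
apply: (emeasurable_fun_cvg (fun j x => (maxN i j x ^+ 4)%:E)).
  by move=> j; exact: measurable_maxN4.
move=> x _; apply: ereal_nondecreasing_is_cvgn; exact: nondecreasing_maxN4.
Qed.

(** The bound of [moricz] is uniform in [j], so monotone convergence carries it to the limit. *)
Lemma integral_supN4_le i (r : R) :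
  (forall j, (i <= j)%N -> \sum_(i <= k < j) e k <= r) ->
  (\int[mu]_(x in D) supN4 i x <= (2 ^+ 12 * K * r ^+ 2)%:E)%E.
Proof.
move=> er.
have cvgI := @cvg_monotone_convergence _ _ _ mu _ mD _ (measurable_maxN4 i) (maxN4_ge0 i)
  (fun x _ => nondecreasing_maxN4 i x).
rewrite -(cvg_lim _ cvgI)//; apply: lime_le; first by apply: cvgP cvgI.
exists i => // j /= ij; apply: le_trans (moricz _ _ ij) _.
rewrite lee_fin ler_wpM2l ?mulr_ge0 ?exprn_ge0//.
have e0 : 0 <= \sum_(i <= k < j) e k by exact: sumr_ge0.
by rewrite lerXn2r ?nnegrE ?e0 ?er// (le_trans e0 (er j ij)).
Qed.

(** The infimum [h] over [i] of [supN4 i] has integral 0, because the integrals of [supN4 i] become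
    arbitrarily small. Hence [h] vanishes almost everywhere, and where it does, some [supN4 i x] is
    below r^4. *)
Lemma ae_cauchy_of_fourth_moments :
  {ae mu, forall x, D x ->
    forall r : R, 0 < r -> exists i, forall j, (i <= j)%N -> N i j x < r}.
Proof.
pose h x := einfs (supN4^~ x) 0%N.
have mh : measurable_fun D h by apply: measurable_fun_einfs; exact: measurable_supN4.
have h0 x : (0 <= h x)%E.
  by apply: le_ereal_inf_tmp => _ [k /= _ <-]; exact: supN4_ge0.
have hle i x : (h x <= supN4 i x)%E by apply: ereal_inf_lbound; exists i.
have Ih : (\int[mu]_(x in D) h x = 0)%E.
  apply/eqP; rewrite eq_le integral_ge0// andbT; apply/lee_addgt0Pr => r r0.
  rewrite add0e; set A := 2 ^+ 12 * K; have A0 : 0 <= A by rewrite mulr_ge0 ?exprn_ge0.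
  (* This choice gives A s^2 <= A s <= r; the summand 1 keeps the denominator positive when [A] is
     0. *)
  pose s := Num.min 1 (r / (A + 1)).
  have [s0 s1 sr] : [/\ 0 < s, s <= 1 & A * s <= r].
    have rA : 0 < r / (A + 1) by rewrite divr_gt0// ltr_wpDl.
    rewrite lt_min ltr01 rA ge_min lexx; split => //.
    apply: (@le_trans _ _ (A * (r / (A + 1)))); first by rewrite ler_wpM2l// ge_min lexx orbT.
    by rewrite mulrCA ler_piMr ?(ltW r0)// ler_pdivrMr ?mul1r ?ltr_wpDl// lerDl.
  have [i ei] := e_tail _ s0.
  apply: (@le_trans _ _ (\int[mu]_(x in D) supN4 i x)%E).
    apply: ge0_le_integral => //; exact: measurable_supN4.
  apply: le_trans (integral_supN4_le _ _ ei) _; rewrite lee_fin.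
  by apply: le_trans sr; rewrite ler_wpM2l// expr2 ler_piMr// ltW.
have : ae_eq mu D h (cst 0%E).
  apply/(ae_eq_integral_abs mu mD mh); rewrite -[RHS]Ih.
  by apply: eq_integral => x _; rewrite gee0_abs.
apply: filterS => x hx Dx r r0; have hx0 := hx Dx.
have : (h x < (r ^+ 4)%:E)%E by rewrite hx0 lte_fin exprn_gt0.
move=> /ereal_inf_lt[_ [i _ <-] ir]; exists i => j ij.
have := le_lt_trans (le_supN4 _ _ x ij) ir; rewrite lte_fin.
by rewrite ltr_pXn2r ?nnegrE ?N_ge0 ?(ltW r0).
Qed.

End MaximalInequality.

(** * Almost everywhere convergence *)

(** A block beyond [i] is the difference of two blocks starting at [i], so bounds r/2 on the latter
    give the Cauchy criterion. *)
Lemma cvgn_series_of_tails (R : realType) (u : nat -> R) :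
  (forall r : R, 0 < r -> exists i, forall j, (i <= j)%N ->
     `|\sum_(i <= k < j) u k| < r) ->
  cvgn (series u).
Proof.
move=> uC; apply/cauchy_cvgP/cauchy_seriesP => r r0.
have [i ui] := uC (r / 2) (divr_gt0 r0 (ltr0n _ 2)).
exists ([set n | (i <= n)%N], [set n | (i <= n)%N]).
  by split; exists i.
move=> [a b] /= [ia ib].
have E a' b' : (i <= a')%N -> (a' <= b')%N ->
    `|\sum_(a' <= k < b') u k| < r.
  move=> ia' ab'; have -> : \sum_(a' <= k < b') u k =
      \sum_(i <= k < b') u k - \sum_(i <= k < a') u k.
    by rewrite [in RHS](big_cat_nat ia' ab')/= addrAC subrr add0r.
  rewrite (le_lt_trans (ler_normB _ _))// [r]splitr ltrD ?ui//.
  exact: leq_trans ab'.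
have [ab|/ltnW ba] := leqP a b; first exact: E.
by rewrite big_geq// normr0.
Qed.

Lemma cvgn_complex_series_of_tails (R : realType) (u : nat -> R[i]) :
  (forall r : R, 0 < r -> exists i, forall j, (i <= j)%N ->
     Normc.normc (\sum_(i <= k < j) u k) < r) ->
  cvgn (series (u : nat -> (R[i])^o)).
Proof.
move=> uC.
have leRe (z : R[i]) : `|complex.Re z| <= Normc.normc z.
  by case: z => a b /=; rewrite -sqrtr_sqr ler_wsqrtr// lerDl sqr_ge0.
have leIm (z : R[i]) : `|complex.Im z| <= Normc.normc z.
  by case: z => a b /=; rewrite -sqrtr_sqr ler_wsqrtr// lerDr sqr_ge0.
have /cvg_ex[a /= ca] : cvgn (series (fun k => complex.Re (u k))).
  apply: cvgn_series_of_tails => r /uC[i ui]; exists i => j /ui.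
  by rewrite /= -Re_sum; exact: le_lt_trans.
have /cvg_ex[b /= cb] : cvgn (series (fun k => complex.Im (u k))).
  apply: cvgn_series_of_tails => r /uC[i ui]; exists i => j /ui.
  by rewrite /= -Im_sum; exact: le_lt_trans.
apply/cvg_ex; exists (a +i* b)%C; apply/cvgrPdist_lt => -[r r'].
(* The radius is a complex number; positivity forces its imaginary part to be 0. *)
rewrite ltcE/= => /andP[/eqP -> r0].
have r2 : 0 < r / 2 by rewrite divr_gt0.
have ar := proj1 (cvgrPdist_lt _ _) ca _ r2.
have br := proj1 (cvgrPdist_lt _ _) cb _ r2.
near=> n.
have an : `|a - series (fun k => complex.Re (u k)) n| < r / 2 by near: n; exact: ar.
have bn : `|b - series (fun k => complex.Im (u k)) n| < r / 2 by near: n; exact: br.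
rewrite normc_def ltcE/= eqxx/=.
move: an bn; rewrite /series/= -Re_sum -Im_sum.
case: (\sum_(0 <= k < n) u k) => x y /= an bn.
rewrite -[r]ger0_norm ?(ltW r0)// -sqrtr_sqr ltr_sqrt ?exprn_gt0//.
rewrite -[X in X + _]real_normK ?num_real// -[X in _ + X]real_normK ?num_real//.
have := normr_ge0 (a - x); have := normr_ge0 (b - y); nra.
Unshelve. all: by end_near. Qed.

Lemma ler_sum_subset (R : numDomainType) (I : eqType) (f : I -> R) (s t : seq I) :
  (forall k, 0 <= f k) -> uniq s -> uniq t -> {subset s <= t} ->
  \sum_(k <- s) f k <= \sum_(k <- t) f k.
Proof.
move=> f0 us ut st; rewrite [leRHS](bigID [in s])/= -[X in _ <= X + _]big_filter.
rewrite [X in _ <= X + _](perm_big s)/=; first by rewrite lerDl sumr_ge0.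
apply: uniq_perm; rewrite ?filter_uniq// => k.
by rewrite mem_filter andb_idr//; exact: st.
Qed.

(** Finitely many rearranged terms lie, without repetition, in an initial segment of the original
    series, so the rearranged partial sums are bounded by its sum. *)
Lemma square_summable_rearranged_tails (R : realType) (c : nat -> R[i])
    (sigma : nat -> nat) : square_summable c -> injective sigma ->
  forall r : R, 0 < r -> exists i, forall j, (i <= j)%N ->
    \sum_(i <= k < j) Normc.normc (c (sigma k)) ^+ 2 <= r.
Proof.
move=> sc injs r r0; pose e k := Normc.normc (c k) ^+ 2.
have e0 k : 0 <= e k by exact: sqr_ge0.
have cvge : cvgn (series (e \o sigma)).
  apply: nondecreasing_is_cvgn.
    by apply/nondecreasing_seqP => n; rewrite seriesSr lerDl e0.
  pose S := (\sum_(0 <= k <oo) (e k)%:E)%E.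
  have S0 : (0 <= S)%E by apply: nneseries_ge0 => k _ _; rewrite lee_fin.
  exists (fine S) => _ [n _ <-].
  pose M := (\max_(k < n) sigma k).+1.
  apply: (@le_trans _ _ (\sum_(0 <= k < M) e k)).
    rewrite /series/= -(big_map sigma xpredT e).
    have us : uniq [seq sigma k | k <- index_iota 0 n] by rewrite map_inj_uniq// iota_uniq.
    apply: (@ler_sum_subset _ _ e _ (index_iota 0 M) e0 us (iota_uniq 0 _)).
    move=> _ /mapP[k kn ->]; rewrite mem_index_iota /M ltnS/=.
    rewrite mem_index_iota/= in kn.
    exact: (leq_bigmax (Ordinal kn)).
  rewrite -lee_fin fineK ?ge0_fin_numE// -sumEFin.
  apply: nneseries_lim_ge => k _.
  by rewrite lee_fin.
have [[A B] [[i _ Ai] [j _ Bj]] AB] := proj1 (cauchy_seriesP (e \o sigma)) (cvg_cauchy _ cvge) r r0.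
exists (maxn i j) => n ijn.
have := AB (maxn i j, n) (conj (Ai _ (leq_maxl _ _)) (Bj _ (leq_trans (leq_maxr _ _) ijn))).
by rewrite /= => /ltW; apply: le_trans; exact: ler_norm.
Qed.

Theorem corollary1p2 (R : realType) (l : nat) (hl : (1 <= l)%N)
    (m : nat -> nat) (hm : enumeration (dyadic_sums_upto l) m) :
  unconditional_convergence_system
    (fun (k : nat) (x : R) => expi ((m k)%:R * x)).
Proof.
move=> c sc sigma /bij_inj injs; case: hm => mfun minj _.
pose n k := m (sigma k).
have injn : injective n.
  by move=> k k' /minj E; apply: injs; apply: E; rewrite inE.
(* Natural frequencies make each block of the rearranged series an ordinary polynomial evaluated at
   exp(ix). *)
pose P i j : {poly R[i]} := \sum_(i <= k < j) (c (sigma k))%:P * 'X^(n k).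
have PE i j x : (P i j).[expi x] =
    \sum_(i <= k < j) c (sigma k) * expi ((n k)%:R * x).
  rewrite horner_sum; apply: eq_bigr => k _.
  by rewrite hornerCM hornerXn expi_natmul.
have Psupp i j a : (P i j)`_a != 0 -> 4^-1 ^+ l <= bit_weight R a.
  move=> Pa; rewrite leNgt; apply: contra Pa => /lt_geF wa; apply/eqP.
  rewrite coef_sum big1// => k _; rewrite coefCM coefXn.
  case: eqP => [ak|_]; last by rewrite mulr0.
  by move/negP: wa; case; apply: bit_weight_dyadic_sums_upto; rewrite ak; exact: mfun.
have Pl2 i j : \sum_(a < size (P i j)) Normc.normc (P i j)`_a ^+ 2 <=
    \sum_(i <= k < j) Normc.normc (c (sigma k)) ^+ 2.
  by apply: sum_sqr_normc_coef_le; rewrite map_inj_uniq// iota_uniq.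
(* Writing [q.+1] keeps the number of periods positive, as [parseval] requires. *)
have cauchyP q : {ae @lebesgue_measure R, forall x,
    (`[- (q.+1%:R * pi), q.+1%:R * pi]%classic : set R) x ->
    forall r : R, 0 < r -> exists i, forall j, (i <= j)%N ->
      Normc.normc (P i j).[expi x] < r}.
  apply: (@ae_cauchy_of_fourth_moments _ _ R (@lebesgue_measure R)
    `[- (q.+1%:R * pi), q.+1%:R * pi]%classic (measurable_itv _)
    (fun i j x => Normc.normc (P i j).[expi x])
    (fun k => Normc.normc (c (sigma k)) ^+ 2)
    (2 * (q.+1%:R * pi) * 16 ^+ l)) => //.
  - by move=> i j x; exact: normc_ge0.
  - by move=> i x; rewrite PE big_geq// Normc.normc0.
  - move=> i j k x /andP[ij jk]; rewrite [P i k](big_cat_nat ij jk)/=.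
    by rewrite hornerD; exact: le_normcD.
  - by move=> i j; exact: measurable_normc_trig.
  - by move=> k; exact: sqr_ge0.
  - by rewrite !mulr_ge0 ?pi_ge0 ?exprn_ge0.
  - move=> i j _; apply: le_trans (fourth_moment_le _ _ _ _ _ (Psupp i j)) _ => //.
    rewrite lee_fin [leLHS]mulrA ler_wpM2l ?mulr_ge0 ?pi_ge0 ?exprn_ge0//.
    by rewrite lerXn2r ?nnegrE ?Pl2// sumr_ge0// => *; exact: sqr_ge0.
  - exact: square_summable_rearranged_tails.
(* The exceptional sets of the countably many intervals form a null set, and [x] lies in the
   interval with index [Num.bound (|x| / pi)]. *)
apply: filterS (ae_foralln cauchyP) => x xC.
apply: cvgn_complex_series_of_tails => r r0.
have xq : `|x| <= (Num.bound (`|x| / pi)).+1%:R * pi.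
  rewrite -ler_pdivrMr ?pi_gt0//.
  have : 0 <= `|x| / pi by rewrite divr_ge0 ?pi_ge0.
  move=> /archi_boundP/ltW/le_trans; apply; rewrite ler_nat; exact: leqnSn.
have [|i Ni] := xC (Num.bound (`|x| / pi)) _ r r0.
  by rewrite /= in_itv/= -ler_norml.
by exists i => j /Ni; rewrite PE.
Qed.
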